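(* For every Lipschitz function $y:[0,1]\to\mathbb{R}$ with $y(0)=0$, one has $F(y)=+\infty$, where $F(y)=\int_0^1 L(y(t),y'(t))\,dt$ and $L(y,v)=\left(v-\frac{1}{2y}\right)^2$ if $y\neq 0$, $L(y,v)=+\infty$ if $y=0$.
   Context: A Lipschitz function $y$ on $[0,1]$ is differentiable almost everywhere; $y'$ denotes its a.e. defined derivative. The Lagrangian $L:\mathbb{R}\times\mathbb{R}\to[0,+\infty]$ takes the value $+\infty$ at all points $(0,v)$, and $F(y)\in[0,+\infty]$ is the Lebesgue integral over $[0,1]$ of the nonnegative extended-real-valued function $t\mapsto L(y(t),y'(t))$. *)

(* Defs.v *)
From HB Require Import structures.
From mathcomp Require Import all_boot all_order all_algebra.
From mathcomp Require Import all_classical all_reals all_analysis.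
Set Implicit Arguments.
Unset Strict Implicit.
Unset Printing Implicit Defensive.

Import Order.TTheory GRing.Theory Num.Theory.
Import numFieldNormedType.Exports.

Local Open Scope classical_set_scope.
Local Open Scope ring_scope.

Definition lagrangian {R : realType} (y v : R) : \bar R :=
  if y == 0 then +oo%E else ((v - 1 / (2 * y)) ^+ 2)%:E.

(* A function on [0, 1] is represented by a function on R of which only the
   restriction to [0, 1] matters: for 0 < t < 1, derive1 y t depends on nothing
   else.  Where y is not differentiable derive1 y t is a default value; for a
   Lipschitz y this happens only on a Lebesgue-null set and does not affect the
   integral (for a nonnegative integrand, the supremum of the integrals of the
   simple functions below it). *)
Definition action {R : realType} (y : R -> R) : \bar R :=
  (\int[@lebesgue_measure R]_(t in `[0%R, 1%R]) lagrangian (y t) (derive1 y t))%E.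

(* Main.v *)
Require Import Defs.
From mathcomp Require Import all_boot all_order all_algebra.
From mathcomp Require Import all_classical all_reals all_analysis.
From mathcomp Require Import ring lra.
Import Order.TTheory GRing.Theory Num.Theory.
Import numFieldNormedType.Exports.
Local Open Scope classical_set_scope.
Local Open Scope ring_scope.

(** If [y] is [K]-Lipschitz with [y 0 = 0], then [`|y t| <= K * t] and
    [`|y'| <= K], so near [0] the term [1 / (2 * y)] dominates and the Lagrangian
    is at least [M ^+ 2] on an interval of length [(4 * K * M)^-1], for every
    [M >= K].  Hence the action is at least [M / (4 * K)] for all large [M].  The
    bound on [y'] also holds for the default value [0] of [derive1], so almost
    everywhere differentiability plays no role. *)

(* [f] is not assumed measurable: the integral is the supremum of the integrals
   of the simple functions below [f], one of which is [c] on [A] and [0] off [A]. *)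
Lemma le_integral_lower_bound d (T : measurableType d) (R : realType)
    (mu : {measure set T -> \bar R}) (D A : set T) (f : T -> \bar R) (c : R) :
  measurable A -> A `<=` D -> (forall x, D x -> 0 <= f x)%E -> 0 <= c ->
  (forall x, A x -> c%:E <= f x)%E ->
  (c%:E * mu A <= \int[mu]_(x in D) f x)%E.
Proof.
move=> mA AD f0 c0 cf.
pose h := cst_nnsfun T (NngNum c0).
rewrite -(integral_cst mu mA) (integral_nnsfun mu mA h) ge0_integralE//.
apply: ereal_sup_ubound; exists (proj_nnsfun h mA); last first.
  by congr (sintegral mu _); rewrite mrestrict.
move=> x; rewrite -mrestrict /patch.
have [/set_mem xA|xA] := boolP (x \in A).
  by rewrite mem_set; [exact: cf|exact: AD].
by case: ifPn => // /set_mem /f0.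
Qed.

Lemma lagrangian_ge0 (R : realType) (y v : R) : (0 <= lagrangian y v)%E.
Proof. by rewrite /lagrangian; case: ifP => // _; rewrite lee_fin sqr_ge0. Qed.

Lemma lagrangian_ge (R : realType) (M y v : R) :
  `|v| <= M -> 4 * M * `|y| <= 1 -> ((M ^+ 2)%:E <= lagrangian y v)%E.
Proof.
move=> vM yM; rewrite /lagrangian; case: eqVneq => [_|y0]; first exact: leey.
have M0 : 0 <= M := le_trans (normr_ge0 v) vM.
rewrite lee_fin -[leRHS]real_normK ?num_real// lerXn2r ?nnegrE//.
rewrite distrC (le_trans _ (lerB_dist _ _))// lerBrDr.
apply: (le_trans (lerD (lexx M) vM)).
have ny0 : 0 < `|y| by rewrite normr_gt0.
by rewrite div1r normfV normrM ger0_norm// -div1r ler_pdivlMr ?mulr_gt0//; lra.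
Qed.

Lemma derive1_le (R : realType) (y : R -> R) (K x : R) : 0 <= K ->
  (\forall z \near x, `|y z - y x| <= K * `|z - x|) -> `|derive1 y x| <= K.
Proof.
move=> K0 yK.
pose q (h : R) := h^-1 *: (y (h + x) - y x).
have -> : derive1 y x = lim (q @ 0^') by [].
(* A divergent quotient has the default limit [0]; otherwise the bound on the quotients passes to
   the limit. *)
have [cq|/dvgP ->] := pselect (cvg (q @ 0^')); last by rewrite normr0.
rewrite -lim_norm//; apply: limr_le; first exact: is_cvg_norm.
have {}yK : \forall h \near (0 : R), `|y (h + x) - y x| <= K * `|h|.
  have cx : h + x @[h --> (0 : R)] --> x.
    by rewrite -[X in _ --> X]add0r; apply: cvgD => //; exact: cvg_cst.
  near=> h; rewrite -{2}(addrK x h); near: h; exact: cx yK.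
near=> h.
have h0 : h != 0 by near: h; exact: nbhs_dnbhs_neq.
rewrite /q normrZ normfV mulrC ler_pdivrMr ?normr_gt0//.
by near: h; exact: nbhs_dnbhs.
Unshelve. all: by end_near. Qed.

Theorem theorem10 (R : realType) (y : R -> R)
    (y_lip : [lipschitz y x | x in `[0, 1]]) (y0 : y 0 = 0) :
  action y = +oo%E.
Proof.
have [K K1 yK] : exists2 K : R, 1 <= K &
    {in `[0, 1] &, forall s t, `|y s - y t| <= K * `|s - t|}.
  (* The Lipschitz property holds for all large constants, so [1 <= K] can be imposed; it yields
     [s <= 1] below. *)
  near (pinfty_nbhs R) => K; exists K; first by near: K; exact: nbhs_pinfty_ge.
  have yK : K.-lipschitz_[set` `[(0 : R), 1]] y by near: K.
  by move=> s t s01 t01; exact: (yK (s, t)).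
have K0 : 0 < K by lra.
have action_ge (M : R) : K <= M -> ((M / (4 * K))%:E <= action y)%E.
  move=> KM; have M0 : 0 < M by lra.
  pose s := (4 * K * M)^-1.
  have KM0 : 0 < 4 * K * M by rewrite !mulr_gt0.
  have s0 : 0 < s by rewrite invr_gt0.
  have s1 : s <= 1 by rewrite invf_le1//; nra.
  have -> : (M / (4 * K))%:E = ((M ^+ 2)%:E * lebesgue_measure `]0%R, s[)%E.
    rewrite lebesgue_measure_itv/= lte_fin s0 -EFinB subr0 -EFinM; congr _%:E.
    by rewrite /s; field; rewrite !gt_eqF.
  apply: le_integral_lower_bound => //.
  - by move=> t /=; rewrite !in_itv/=; lra.
  - by move=> t _; exact: lagrangian_ge0.
  - exact: sqr_ge0.
  move=> t /=; rewrite in_itv/= => /andP[t0 ts].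
  have t01 : t \in `[0, 1] by rewrite in_itv/=; lra.
  apply: lagrangian_ge.
    apply: le_trans KM; apply: derive1_le; first exact: ltW.
    (* Points near an interior [t] stay in the interval where the Lipschitz bound is available. *)
    have tI : t \in `]0, 1[ by rewrite in_itv/=; lra.
    near=> z; apply: yK => //.
    have : z \in `]0, 1[ by near: z; exact: near_in_itvoo.
    exact: subset_itv_oo_cc.
  have := yK t 0 t01; rewrite in_itv/= lexx ler01 => /(_ isT).
  rewrite y0 !subr0 (gtr0_norm t0) => yt.
  have sE : s * (4 * K * M) = 1 by rewrite mulVf// gt_eqF.
  by nra.
apply/eqyP => r r0.
(* This [M] is at least [K], and [M / (4 * K) = 1 / 4 + r]. *)
apply: le_trans (action_ge (K + 4 * K * r) _); last by nra.
by rewrite lee_fin ler_pdivlMr; nra.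
Unshelve. all: by end_near. Qed.
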